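(* Let $\mathcal{H}_1,\mathcal{H}_2$ be Hilbert spaces, let $\Psi=(\psi_k)$ be a Bessel sequence in $\mathcal{H}_1$ with bound $B$, and let $\Phi=(\phi_k)$ be a Bessel sequence in $\mathcal{H}_2$ with bound $B'$. 1. Let $O:\mathcal{H}_1\to\mathcal{H}_2$ be a bounded linear operator. Then the infinite matrix $$\left(\mathcal{M}^{(\Phi,\Psi)}(O)\right)_{m,n}=\langle O\psi_n,\phi_m\rangle$$ defines a bounded operator from $l^2$ to $l^2$ with $$\|\mathcal{M}^{(\Phi,\Psi)}(O)\|_{l^2\to l^2}\le\sqrt{B B'}\,\|O\|_{\mathcal{H}_1\to\mathcal{H}_2},$$ and, as an operator $l^2\to l^2$, $\mathcal{M}^{(\Phi,\Psi)}(O)=C_\Phi\circ O\circ D_\Psi$. Consequently $\mathcal{M}^{(\Phi,\Psi)}:\mathcal{B}(\mathcal{H}_1,\mathcal{H}_2)\to\mathcal{B}(l^2,l^2)$ is a well-defined bounded linear operator. 2. Let $M=(M_{i,k})$ be an infinite matrix defining a bounded operator from $l^2$ to $l^2$ by $(Mc)_i=\sum_k M_{i,k}c_k$. Then the operator $\mathcal{O}^{(\Phi,\Psi)}(M)$ defined by $$\left(\mathcal{O}^{(\Phi,\Psi)}(M)\right)h=\sum_k\left(\sum_j M_{k,j}\langle h,\psi_j\rangle\right)\phi_k,\qquad h\in\mathcal{H}_1,$$ is a bounded operator from $\mathcal{H}_1$ to $\mathcal{H}_2$ with $$\|\mathcal{O}^{(\Phi,\Psi)}(M)\|_{\mathcal{H}_1\to\mathcal{H}_2}\le\sqrt{B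 B'}\,\|M\|_{l^2\to l^2},$$ and $$\mathcal{O}^{(\Phi,\Psi)}(M)=D_\Phi\circ M\circ C_\Psi=\sum_k\sum_j M_{k,j}\,\phi_k\otimes_i\overline{\psi}_j ,$$ where the double sum is the iterated sum, applied to each vector $h\in\mathcal{H}_1$. Consequently $\mathcal{O}^{(\Phi,\Psi)}:\mathcal{B}(l^2,l^2)\to\mathcal{B}(\mathcal{H}_1,\mathcal{H}_2)$ is a well-defined bounded linear operator.
   Context: Hilbert spaces are complex and infinite-dimensional, with inner product linear in the first argument. All sequences are indexed by a countable set $K$ and $l^2=l^2(K)$. $\mathcal{B}(X,Y)$ is the Banach space of bounded linear operators from $X$ to $Y$ with operator norm $\|\cdot\|_{X\to Y}$. Bounded operators on $l^2$ are identified with the infinite matrices that define them. A sequence $(\psi_k)$ in $\mathcal{H}$ is a Bessel sequence with bound $B$ if $\sum_k|\langle f,\psi_k\rangle|^2\le B\|f\|^2$ for all $f\in\mathcal{H}$. For a Bessel sequence $\Psi=(\psi_k)$ in $\mathcal{H}$, the analysis operator is $C_\Psi:\mathcal{H}\to l^2$, $C_\Psi f=(\langle f,\psi_k\rangle)_k$, and the synthesis operator is $D_\Psi:l^2\to\mathcal{H}$, $D_\Psi c=\sum_k c_k\psi_k$. For $f\in\mathcal{H}_2$, $g\in\mathcal{H}_1$, the inner tensor product $f\otimes_i\overline{g}$ is the operator $\mathcal{H}_1\to\mathcal{H}_2$ given by $(f\otimes_i\overline{g})(h)=\langle h,g\rangle f$. *)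

(* Defs.v *)
From HB Require Import structures.
From mathcomp Require Import all_boot all_order all_algebra.
From mathcomp Require Import finmap.
From mathcomp Require Import all_classical all_reals all_analysis.
From mathcomp.analysis.showcase Require summability.
From mathcomp.real_closed Require Import complex.
From mathcomp Require Import ring.

Set Implicit Arguments.
Unset Strict Implicit.
Unset Printing Implicit Defensive.

Import Order.TTheory GRing.Theory Num.Theory.
Import numFieldNormedType.Exports.

Local Open Scope classical_set_scope.
Local Open Scope complex_scope.
Local Open Scope ring_scope.

#[export] Existing Instance summability.totally_filter.

(* Over R[i], norms take values in R[i]; [nrm] is the same norm as a real. *)
Section nrm.
Variables (R : realType) (V : normedZmodType R[i]).
Implicit Types x y : V.

Definition nrm x : R := complex.Re `|x|.

Lemma nrmE x : (nrm x)%:C = `|x|.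
Proof. by rewrite /nrm RRe_real// normr_real. Qed.

Lemma nrm_ge0 x : 0 <= nrm x.
Proof. by rewrite -ler0c nrmE normr_ge0. Qed.

Lemma ler_nrmD x y : nrm (x + y) <= nrm x + nrm y.
Proof. by rewrite -lecR rmorphD /= !nrmE ler_normD. Qed.

Lemma nrm0 : nrm (0 : V) = 0.
Proof. by rewrite /nrm normr0. Qed.

Lemma nrm0_eq0 x : nrm x = 0 -> x = 0.
Proof. by move=> x0; apply/eqP; rewrite -normr_eq0 -nrmE x0. Qed.

End nrm.

Lemma nrmM (R : realType) (a b : R[i]) : nrm (a * b) = nrm a * nrm b.
Proof. by apply: complexI; rewrite rmorphM /= !nrmE normrM. Qed.

Lemma nrmZ (R : realType) (V : normedModType R[i]) (a : R[i]) (x : V) :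
  nrm (a *: x) = nrm a * nrm x.
Proof. by apply: complexI; rewrite rmorphM /= !nrmE normrZ. Qed.

(* Sums over an index set with no preferred order are limits along the finite
   subsets, i.e. unconditional sums. *)
Section unconditional_sums.
Variables (K : choiceType) (R : realType) (V : normedModType R[i]).

Definition has_sum (x : K -> V) (s : V) : Prop :=
  summability.partial_sum x @ summability.totally --> s.

(* [family_sum x] is a junk value unless [summable_family x]. *)
Definition summable_family (x : K -> V) : Prop :=
  cvg (summability.partial_sum x @ summability.totally).

Definition family_sum (x : K -> V) : V := summability.sum x.

End unconditional_sums.

HB.mixin Record NormedModule_isHilbert (R : realType) H
    & CompleteNormedModule R[i] H := {
  inner : {dot H for Num.conj} ;
  hilbert_normE : forall x : H, `|x| ^+ 2 = inner x x
}.

#[short(type="hilbertType")]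
HB.structure Definition Hilbert (R : realType) :=
  {H of NormedModule_isHilbert R H & CompleteNormedModule R[i] H}.

Definition infinite_dimensional (F : fieldType) (V : lmodType F) : Prop :=
  ~ exists s : seq V, forall x : V,
      exists a : 'I_(size s) -> F, x = \sum_(i < size s) a i *: s`_i.

Section l2_pred.
Variables (K : countType) (R : realType).
Implicit Types c d : K -> R[i].

Definition sqsum c : \bar R := \esum_(k in [set: K]) (nrm (c k) ^+ 2)%:E.

Definition square_summable : {pred K -> R[i]} :=
  fun c => `[< (sqsum c < +oo)%E >].

Definition seqnorm c : R := Num.sqrt (fine (sqsum c)).

Lemma sqsum_ge0 c : (0 <= sqsum c)%E.
Proof. by apply: esum_ge0 => k _; rewrite lee_fin sqr_ge0. Qed.

Lemma sqsum_le c (M : R) : (sqsum c <= M%:E)%E <->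
  forall A : {fset K}, \sum_(k <- A) nrm (c k) ^+ 2 <= M.
Proof.
split=> [cM A|cM].
  rewrite -lee_fin -sumEFin (le_trans _ cM)//.
  apply: esum_ge; exists [set` A]; first by split.
  by rewrite fsbig_finite//= set_fsetK.
apply: ge_ereal_sup => _ [A [finA _] <-].
by rewrite fsbig_finite//= sumEFin lee_fin.
Qed.

Lemma seqnorm_ge0 c : 0 <= seqnorm c.
Proof. exact: sqrtr_ge0. Qed.

Lemma seqnormE c : c \in square_summable -> sqsum c = (seqnorm c ^+ 2)%:E.
Proof.
move=> /asboolP cfin; rewrite /seqnorm sqr_sqrtr ?fine_ge0 ?sqsum_ge0//.
by rewrite fineK// ge0_fin_numE// sqsum_ge0.
Qed.

Lemma seqnorm_le c (M : R) : 0 <= M ->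
  (forall A : {fset K}, \sum_(k <- A) nrm (c k) ^+ 2 <= M ^+ 2) ->
  c \in square_summable /\ seqnorm c <= M.
Proof.
move=> M0 /sqsum_le cM.
have cl2 : c \in square_summable.
  by apply/asboolP; rewrite (le_lt_trans cM) ?ltry.
split=> //; rewrite -(@ler_pXn2r _ 2)// ?nnegrE ?seqnorm_ge0//.
by rewrite -lee_fin -seqnormE.
Qed.

Lemma seqnorm_ubound c (A : {fset K}) : c \in square_summable ->
  \sum_(k <- A) nrm (c k) ^+ 2 <= seqnorm c ^+ 2.
Proof. by move=> cl2; move: A; apply/sqsum_le; rewrite seqnormE. Qed.

Let sqD_le (x y s t : R) : 0 < s -> 0 < t ->
  (x + y) ^+ 2 <= (s + t) * (x ^+ 2 / s + y ^+ 2 / t).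
Proof.
move=> s0 t0; rewrite -subr_ge0.
have -> : (s + t) * (x ^+ 2 / s + y ^+ 2 / t) - (x + y) ^+ 2 =
    (t * x - s * y) ^+ 2 / (s * t).
  by field; rewrite !gt_eqF.
by rewrite divr_ge0 ?sqr_ge0// mulr_ge0// ltW.
Qed.

Lemma seqnormD c d : c \in square_summable -> d \in square_summable ->
  (c + d) \in square_summable /\ seqnorm (c + d) <= seqnorm c + seqnorm d.
Proof.
move=> cl2 dl2.
have H (e : R) : 0 < e -> c + d \in square_summable /\
    seqnorm (c + d) <= (seqnorm c + e) + (seqnorm d + e).
  move=> e0; set s := seqnorm c + e; set t := seqnorm d + e.
  have s0 : 0 < s by rewrite ltr_wpDl// seqnorm_ge0.
  have t0 : 0 < t by rewrite ltr_wpDl// seqnorm_ge0.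
  apply: seqnorm_le => [|A]; first by rewrite addr_ge0 ?ltW.
  apply: (@le_trans _ _ (\sum_(k <- A)
      (s + t) * (nrm (c k) ^+ 2 / s + nrm (d k) ^+ 2 / t))).
    apply: ler_sum => k _; rewrite (le_trans _ (sqD_le _ _ s0 t0))//.
    by rewrite ler_pXn2r ?nnegrE ?nrm_ge0 ?ler_nrmD// addr_ge0 ?nrm_ge0.
  have st0 : 0 <= s + t by exact: addr_ge0 (ltW s0) (ltW t0).
  rewrite -mulr_sumr expr2 ler_wpM2l//.
  rewrite big_split/= -!mulr_suml lerD// ler_pdivrMr// -expr2.
    rewrite (le_trans (seqnorm_ubound A cl2))//.
    by rewrite ler_pXn2r ?nnegrE ?seqnorm_ge0 ?(ltW s0)// lerDl ltW.
  rewrite (le_trans (seqnorm_ubound A dl2))//.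
  by rewrite ler_pXn2r ?nnegrE ?seqnorm_ge0 ?(ltW t0)// lerDl ltW.
split; first by have [] := H 1 ltr01.
apply/ler_addgt0Pr => e e0; have [_] := H (e / 2) (divr_gt0 e0 (ltr0Sn R 1)).
by rewrite addrACA -splitr.
Qed.

Lemma sqsumZ (a : R[i]) c :
  c \in square_summable -> (a *: c) \in square_summable /\
  seqnorm (a *: c) <= nrm a * seqnorm c.
Proof.
move=> cl2; apply: seqnorm_le => [|A].
  by rewrite mulr_ge0 ?nrm_ge0 ?seqnorm_ge0.
under eq_bigr => k _ do rewrite nrmM exprMn.
by rewrite -mulr_sumr exprMn ler_wpM2l ?sqr_ge0// seqnorm_ubound.
Qed.

Lemma seqnormZ (a : R[i]) c : c \in square_summable ->
  seqnorm (a *: c) = nrm a * seqnorm c.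
Proof.
move=> cl2; have [acl2 aZ] := sqsumZ a cl2.
apply/eqP; rewrite eq_le aZ/=.
have [->|a0] := eqVneq a 0; first by rewrite nrm0 mul0r seqnorm_ge0.
have na0 : 0 < nrm a.
  by rewrite lt_neqAle nrm_ge0 andbT eq_sym; apply: contra a0 => /eqP/nrm0_eq0->.
have [_] := sqsumZ a^-1 acl2; rewrite scalerA mulVf// scale1r.
rewrite -(ler_pM2l na0) mulrA -nrmM mulfV// => /le_trans; apply.
by rewrite /nrm normr1 mul1r.
Qed.

Lemma seqnorm0_eq0 c : c \in square_summable -> seqnorm c = 0 -> c = 0.
Proof.
move=> cl2 c0; apply/funext => k; apply: nrm0_eq0.
apply/eqP; rewrite -sqrf_eq0 eq_le sqr_ge0 andbT.
by have := seqnorm_ubound [fset k]%fset cl2; rewrite big_seq_fset1 c0 expr0n.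
Qed.

Lemma square_summable_submod_closed : submod_closed square_summable.
Proof.
split.
  have [] := @seqnorm_le 0 0 => // A.
  by rewrite big1 ?expr0n// => k _; rewrite nrm0 expr0n.
by move=> a c d cl2 dl2; have [? _] := seqnormD (sqsumZ a cl2).1 dl2.
Qed.

HB.instance Definition _ := GRing.isSubmodClosed.Build R[i] (K -> R[i])
  square_summable square_summable_submod_closed.

End l2_pred.

Record l2 (K : countType) (R : realType) := L2 {
  l2_val :> K -> R[i] ;
  l2_valP : l2_val \in @square_summable K R
}.

Section l2.
Variables (K : countType) (R : realType).

HB.instance Definition _ := [isSub for @l2_val K R].
HB.instance Definition _ := [Choice of l2 K R by <:].
HB.instance Definition _ := [SubChoice_isSubLmodule of l2 K R by <:].

Definition l2_norm (c : l2 K R) : R[i] := (seqnorm c)%:C.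

Let l2_normD (c d : l2 K R) : l2_norm (c + d) <= l2_norm c + l2_norm d.
Proof.
by rewrite -rmorphD lecR; have [] := seqnormD (l2_valP c) (l2_valP d).
Qed.

Let l2_normZ (a : R[i]) (c : l2 K R) : l2_norm (a *: c) = `|a| * l2_norm c.
Proof. by rewrite -nrmE -rmorphM/= -(seqnormZ _ (l2_valP c)). Qed.

Let l2_norm0_eq0 (c : l2 K R) : l2_norm c = 0 -> c = 0.
Proof. by move=> /complexI c0; apply/val_inj/seqnorm0_eq0/c0/l2_valP. Qed.

HB.instance Definition _ :=
  Lmodule_isNormed.Build R[i] (l2 K R) l2_normD l2_normZ l2_norm0_eq0.

End l2.

Section bounded_linear.
Variables (R : realType) (X Y : normedModType R[i]).
Implicit Types f g : X -> Y.

Definition bounded_linear : {pred X -> Y} :=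
  fun f => `[< linear f /\ exists M : R, forall x, nrm (f x) <= M * nrm x >].

Definition unit_ball_values f : set R :=
  [set nrm (f x) | x in [set x | nrm x <= 1]].

Definition opnorm f : R := sup (unit_ball_values f).

Lemma unit_ball_values_has_sup f : f \in bounded_linear ->
  has_sup (unit_ball_values f).
Proof.
move=> /asboolP[_ [M fM]]; split; first by exists (nrm (f 0)), 0; rewrite //= nrm0.
exists `|M| => _ [x /= x1 <-]; rewrite (le_trans (fM x))//.
rewrite (le_trans (ler_wpM2r (nrm_ge0 x) (ler_norm M)))//.
by rewrite ler_piMr.
Qed.

Lemma opnorm_ge0 f : f \in bounded_linear -> 0 <= opnorm f.
Proof.
move=> fbl; apply: (le_trans (nrm_ge0 (f 0))).
apply: sup_ubound; first by have [] := unit_ball_values_has_sup fbl.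
by exists 0; rewrite //= nrm0.
Qed.

Lemma opnorm_bound f x : f \in bounded_linear ->
  nrm (f x) <= opnorm f * nrm x.
Proof.
move=> fbl; have /asboolP[flin _] := fbl.
have f0 : f 0 = 0.
  by have := flin (-1) 0 0; rewrite scaler0 addr0 scaleN1r addNr.
have fZ (a : R[i]) y : f (a *: y) = a *: f y.
  by have := flin a y 0; rewrite addr0 f0 addr0.
have [->|x0] := eqVneq x 0; first by rewrite f0 !nrm0 mulr0.
have nx0 : 0 < nrm x.
  by rewrite lt_neqAle nrm_ge0 andbT eq_sym; apply: contra x0 => /eqP/nrm0_eq0->.
rewrite -ler_pdivrMr//.
have nV : nrm ((nrm x)^-1)%:C = (nrm x)^-1.
  by rewrite /nrm ger0_norm// ler0c invr_ge0 nrm_ge0.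
apply: sup_ubound; first by have [] := unit_ball_values_has_sup fbl.
exists (((nrm x)^-1)%:C *: x).
  by rewrite /= nrmZ nV mulVf ?gt_eqF.
by rewrite fZ nrmZ nV mulrC.
Qed.

Lemma opnorm_le f (M : R) : 0 <= M -> (forall x, nrm (f x) <= M * nrm x) ->
  opnorm f <= M.
Proof.
move=> M0 fM; apply: ge_sup; first by exists (nrm (f 0)), 0; rewrite //= nrm0.
by move=> _ [x /= x1 <-]; rewrite (le_trans (fM x))// ler_piMr.
Qed.

Lemma bounded_linear_submod_closed : submod_closed bounded_linear.
Proof.
split.
  apply/asboolP; split; first by move=> a x y; rewrite scaler0 addr0.
  by exists 0 => x; rewrite nrm0 mul0r.
move=> a f g /asboolP[flin [M fM]] /asboolP[glin [N gN]]; apply/asboolP; split.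
  move=> b x y; rewrite /= !fctE flin glin !scalerDr !scalerA (mulrC a b).
  by rewrite addrACA.
exists (nrm a * M + N) => x; rewrite (le_trans (ler_nrmD _ _))//.
rewrite mulrDl lerD//; rewrite nrmZ -mulrA ler_wpM2l ?nrm_ge0//.
Qed.

HB.instance Definition _ := GRing.isSubmodClosed.Build R[i] (X -> Y)
  bounded_linear bounded_linear_submod_closed.

End bounded_linear.

Record bounded_op (R : realType) (X Y : normedModType R[i]) := BoundedOp {
  bounded_op_val :> X -> Y ;
  bounded_opP : bounded_op_val \in @bounded_linear R X Y
}.

Section bounded_op.
Variables (R : realType) (X Y : normedModType R[i]).
Local Notation B := (bounded_op X Y).

HB.instance Definition _ := [isSub for @bounded_op_val R X Y].
HB.instance Definition _ := [Choice of B by <:].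
HB.instance Definition _ := [SubChoice_isSubLmodule of B by <:].

HB.instance Definition _ (T : B) :=
  GRing.isLinear.Build R[i] X Y *:%R T
    (let: conj lin _ := asboolW (bounded_opP T) in lin).

Definition bounded_op_norm (T : B) : R[i] := (opnorm T)%:C.

Let bounded_op_normD (S T : B) :
  bounded_op_norm (S + T) <= bounded_op_norm S + bounded_op_norm T.
Proof.
rewrite -rmorphD lecR; apply: opnorm_le => [|x].
  by rewrite addr_ge0 ?opnorm_ge0 ?bounded_opP.
by rewrite (le_trans (ler_nrmD _ _))// mulrDl lerD ?opnorm_bound ?bounded_opP.
Qed.

Let opnormZ_le (a : R[i]) (T : B) : opnorm (a *: T) <= nrm a * opnorm T.
Proof.
apply: opnorm_le => [|x].
  by rewrite mulr_ge0 ?nrm_ge0 ?opnorm_ge0 ?bounded_opP.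
by rewrite nrmZ -mulrA ler_wpM2l ?nrm_ge0// opnorm_bound ?bounded_opP.
Qed.

Let bounded_op_normZ (a : R[i]) (T : B) :
  bounded_op_norm (a *: T) = `|a| * bounded_op_norm T.
Proof.
rewrite -nrmE -rmorphM/=; congr (_%:C); apply/eqP; rewrite eq_le opnormZ_le/=.
have [->|a0] := eqVneq a 0; first by rewrite nrm0 mul0r; exact: opnorm_ge0 (bounded_opP (0 *: T)).
have na0 : 0 < nrm a.
  by rewrite lt_neqAle nrm_ge0 andbT eq_sym; apply: contra a0 => /eqP/nrm0_eq0->.
have := opnormZ_le a^-1 (a *: T : B); rewrite scalerA mulVf// scale1r.
rewrite -(ler_pM2l na0) mulrA -nrmM mulfV// => /le_trans; apply.
by rewrite /nrm normr1 mul1r.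
Qed.

Let bounded_op_norm0_eq0 (T : B) : bounded_op_norm T = 0 -> T = 0.
Proof.
move=> /complexI T0; apply/val_inj/funext => x; apply: nrm0_eq0.
apply/eqP; rewrite eq_le nrm_ge0 andbT.
by rewrite (le_trans (opnorm_bound x (bounded_opP T)))// T0 mul0r.
Qed.

HB.instance Definition _ := Lmodule_isNormed.Build R[i] B
  bounded_op_normD bounded_op_normZ bounded_op_norm0_eq0.

End bounded_op.

Notation "''B' ( X , Y )" := (bounded_op X Y)
  (at level 8, format "''B' ( X ,  Y )") : type_scope.

Section bessel.
Variables (R : realType) (K : countType) (H : hilbertType R).

Definition bessel (B : R) (psi : K -> H) : Prop := forall f : H,
  (\esum_(k in [set: K]) (nrm (inner f (psi k)) ^+ 2)%:E
     <= (B * nrm f ^+ 2)%:E)%E.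

Lemma bessel_square_summable B psi (f : H) : bessel B psi ->
  (fun k => inner f (psi k)) \in @square_summable K R.
Proof. by move=> /(_ f) hf; apply/asboolP; rewrite (le_lt_trans hf) ?ltry. Qed.

Definition analysis B psi (hpsi : bessel B psi) (f : H) : l2 K R :=
  L2 (bessel_square_summable f hpsi).

Definition synthesis (psi : K -> H) (c : l2 K R) : H :=
  family_sum (fun k => c k *: psi k).

End bessel.

Section operators.
Variables (R : realType) (K : countType).

(* The value type is written R[i]^o because the topology of R[i] is attached to
   that alias. *)
Definition matrix_defines (M : K -> K -> R[i]) (T : 'B(l2 K R, l2 K R)) : Prop :=
  forall (c : l2 K R) (i : K),
    @has_sum K R R[i]^o (fun k => M i k * c k) (T c i).

Variables H1 H2 : hilbertType R.

Definition inner_tensor (f : H2) (g : H1) : H1 -> H2 :=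
  fun h => inner h g *: f.

Definition operator_matrix (phi : K -> H2) (psi : K -> H1) (O : 'B(H1, H2)) :
  K -> K -> R[i] := fun m n => inner (O (psi n)) (phi m).

Definition matrix_coeff (psi : K -> H1) (M : K -> K -> R[i]) (h : H1) (k : K) :
  R[i] := @family_sum K R R[i]^o (fun j => M k j * inner h (psi j)).

Definition matrix_operator (phi : K -> H2) (psi : K -> H1)
    (M : K -> K -> R[i]) : H1 -> H2 :=
  fun h => family_sum (fun k => matrix_coeff psi M h k *: phi k).

End operators.

(* Main.v *)
(** For finite sums, |sum_A c_k psi_k|^2 <= B * sum_A |c_k|^2; the l^2 tails of
    [c] make the synthesis series Cauchy, and D_Psi is bounded by sqrt B, as C_Psi
    is by the Bessel inequality. Both correspondences are then the maps
    O |-> C_Phi O D_Psi and T |-> D_Phi T C_Psi, linear and bounded because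
    composition is. The matrix formulas follow because bounded linear maps
    (coordinates of l^2, a |-> a *: v) commute with unconditional sums.
    A nonzero vector, supplied by infinite dimension, forces B, B' >= 0. *)
Require Import Defs.
From mathcomp Require Import all_boot all_order all_algebra finmap.
From mathcomp Require Import all_classical all_reals all_analysis.
From mathcomp.analysis.showcase Require summability.
From mathcomp.real_closed Require Import complex.
From mathcomp Require Import ring lra.
Import Order.TTheory GRing.Theory Num.Theory.
Import numFieldNormedType.Exports.
Local Open Scope complex_scope.
Local Open Scope classical_set_scope.
Local Open Scope ring_scope.
Set Implicit Arguments.
Unset Strict Implicit.
Unset Printing Implicit Defensive.

Lemma nrm_real (R : realType) (a : R) : 0 <= a -> nrm (a%:C : R[i]^o) = a.
Proof. by move=> a0; rewrite /nrm ger0_norm// ler0c. Qed.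

(** Positivity in the order of [R[i]] forces the imaginary part to vanish, so complex tolerances in
    the topology can be traded for real ones. *)
Lemma gt0_RRe (R : realType) (e : R[i]) : 0 < e -> (complex.Re e)%:C = e.
Proof. by move=> e0; rewrite RRe_real// gtr0_real. Qed.

(** * Unconditional sums in normed spaces *)

Section has_sum_theory.
Variables (R : realType) (K : choiceType).
Implicit Types V W : normedModType R[i].

Lemma has_sumP V (x : K -> V) (s : V) : has_sum x s <->
  forall e : R, 0 < e -> exists A : {fset K}, forall B : {fset K},
    (A `<=` B)%fset -> nrm (s - \sum_(k <- B) x k) < e.
Proof.
rewrite /has_sum; split => [xs e e0|xs].
  have e0' : (0 : R[i]) < e%:C by rewrite (@ltcR _ 0).
  have [A _ As] := (cvgrPdist_lt _ _).1 xs _ e0'.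
  by exists A => B /As; rewrite /= big_seq_fsetE -nrmE ltcR.
apply/cvgrPdist_lt => e e0.
have eE := gt0_RRe e0; have : 0 < complex.Re e by rewrite -ltcR eE.
move=> /xs[A As]; exists A => // B /As.
by rewrite -ltcR nrmE eE big_seq_fsetE.
Qed.

Lemma has_sum_family_sum V (x : K -> V) (s : V) :
  has_sum x s -> family_sum x = s.
Proof. by move=> xs; apply: cvg_lim => //; exact: norm_hausdorff. Qed.

Lemma has_sum_summable V (x : K -> V) (s : V) :
  has_sum x s -> summable_family x.
Proof. by move=> xs; apply/cvg_ex; exists s. Qed.

Lemma summable_has_sum V (x : K -> V) :
  summable_family x -> has_sum x (family_sum x).
Proof. by []. Qed.

Lemma has_sum_lin V (a : R[i]) (x y : K -> V) (s t : V) :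
  has_sum x s -> has_sum y t ->
  has_sum (fun k => a *: x k + y k) (a *: s + t).
Proof.
move=> xs yt; rewrite /has_sum.
have -> : summability.partial_sum (fun k => a *: x k + y k) =
    (fun A => a *: summability.partial_sum x A + summability.partial_sum y A).
  apply/funext => A; rewrite /summability.partial_sum big_split/=.
  by rewrite scaler_sumr.
by apply: cvgD => //; exact: cvgZr.
Qed.

Lemma has_sum_bounded_linear V W (f : V -> W) (x : K -> V) (s : V) :
  f \in @bounded_linear R V W -> has_sum x s -> has_sum (f \o x) (f s).
Proof.
move=> fbl /has_sumP xs; apply/has_sumP => e e0.
(* Adding 1 keeps the divisor in [e / M] positive even when [f] is zero; the bundled [T] carries the
   linear structure that moves [f] through finite sums. *)
pose T := BoundedOp fbl; pose M := opnorm f + 1.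
have M0 : 0 < M by rewrite ltr_wpDl// opnorm_ge0.
have [A As] := xs _ (divr_gt0 e0 M0).
exists A => B /As; rewrite ltr_pdivlMr// mulrC; apply: le_lt_trans.
have -> : f s - \sum_(k <- B) (f \o x) k = T (s - \sum_(k <- B) x k).
  by rewrite [RHS]linearB [in RHS]linear_sum.
rewrite (le_trans (opnorm_bound _ fbl))// ler_wpM2r ?nrm_ge0//.
by rewrite lerDl.
Qed.

Lemma has_sum_nrm_le V (x : K -> V) (s : V) (M : R) :
  (forall A : {fset K}, nrm (\sum_(k <- A) x k) <= M) -> has_sum x s ->
  nrm s <= M.
Proof.
move=> xM /has_sumP xs; apply/ler_addgt0Pr => e /xs[A /(_ A (fsubset_refl A))].
move=> /ltW sA; rewrite -(subrK (\sum_(k <- A) x k) s).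
by rewrite (le_trans (ler_nrmD _ _))// addrC lerD.
Qed.

Lemma big_fset_sub (V : zmodType) (x : K -> V) (A B : {fset K}) :
  (A `<=` B)%fset ->
  \sum_(k <- B) x k - \sum_(k <- A) x k = \sum_(k <- (B `\` A)%fset) x k.
Proof.
move=> AB; rewrite (big_fsetID _ (mem A) B) /=.
have -> : [fset k in B | k \in A]%fset = A.
  apply/fsetP => k; rewrite !inE /= andbC.
  by case kA : (k \in A) => //=; exact: (fsubsetP AB).
have -> : [fset k in B | k \notin A]%fset = (B `\` A)%fset.
  by apply/fsetP => k; rewrite !inE /= andbC.
by rewrite addrAC subrr add0r.
Qed.

(** The partial sum over any finite set above [A] lies within [e] of the one over [A], which serves
    as the centre of the Cauchy ball; completeness supplies the limit. *)
Lemma summable_family_cauchy (V : completeNormedModType R[i]) (x : K -> V) :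
  (forall e : R, 0 < e -> exists A : {fset K}, forall B : {fset K},
    (A `<=` B)%fset -> nrm (\sum_(k <- (B `\` A)%fset) x k) < e) ->
  summable_family x.
Proof.
move=> xc; apply/cauchy_cvgP/cauchy_exP => e e0.
have eE := gt0_RRe e0; have : 0 < complex.Re e by rewrite -ltcR eE.
move=> /xc[A Ae]; exists (\sum_(k <- A) x k); exists A => // B /= AB.
rewrite -ball_normE /= /summability.partial_sum -(big_seq_fsetE _ _ predT).
by rewrite distrC big_fset_sub// -nrmE -eE ltcR Ae.
Qed.

End has_sum_theory.

(** The finite sums of squares are bounded, so some [A] comes within [e] of their supremum; whatever
    is added beyond [A] must fit in that gap. *)
Lemma square_summable_tail (R : realType) (K : countType) (c : K -> R[i])
    (e : R) : c \in @square_summable K R -> 0 < e ->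
  exists A : {fset K}, forall B : {fset K}, (A `<=` B)%fset ->
    \sum_(k <- (B `\` A)%fset) nrm (c k) ^+ 2 < e.
Proof.
move=> cl2 e0; pose E := range (fun A : {fset K} => \sum_(k <- A) nrm (c k) ^+ 2).
have supE : has_sup E.
  split; first by exists (\sum_(k <- fset0) nrm (c k) ^+ 2), fset0.
  by exists (seqnorm c ^+ 2) => _ [A _ <-]; exact: seqnorm_ubound.
have [_ [A _ <-] supA] := sup_adherent e0 supE.
exists A => B AB; rewrite -(big_fset_sub _ AB).
have : \sum_(k <- B) nrm (c k) ^+ 2 <= sup E.
  by apply: sup_ubound; [case: supE | exists B].
by lra.
Qed.

(** The empty list already spans the zero space. *)
Lemma infinite_dimensional_nonzero (F : fieldType) (V : lmodType F) :
  infinite_dimensional V -> exists x : V, x != 0.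
Proof.
move=> infV; apply: contrapT => V0; apply: infV; exists [::] => x.
exists (fun=> 0); rewrite big_ord0; apply/eqP.
by apply: contrapT => /negP x0; apply: V0; exists x.
Qed.

Section inner_theory.
Variables (R : realType) (H : hilbertType R).
Implicit Types x y : H.

Lemma innerC x y : inner x y = (inner y x)^*.
Proof. by rewrite hermC expr0 mul1r. Qed.

Lemma nrm_innerC x y : nrm (inner x y) = nrm (inner y x).
Proof. by rewrite innerC /nrm norm_conjC. Qed.

Lemma innerxx x : nrm (inner x x) = nrm x ^+ 2.
Proof.
by rewrite -hilbert_normE -nrmE -rmorphXn nrm_real// sqr_ge0.
Qed.

End inner_theory.

(** * Analysis and synthesis operators of a Bessel sequence *)

Section bessel_theory.
Variables (R : realType) (K : countType) (H : hilbertType R).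
Variables (B : R) (psi : K -> H).
Hypothesis hpsi : bessel B psi.

Lemma bessel_fset (f : H) (A : {fset K}) :
  \sum_(k <- A) nrm (inner f (psi k)) ^+ 2 <= B * nrm f ^+ 2.
Proof. by move: A; apply/sqsum_le/hpsi. Qed.

(** Over the empty index set the Bessel inequality reads [0 <= B * nrm x ^+ 2], which fixes the sign
    of [B] once [x] is nonzero. *)
Lemma bessel_ge0 : infinite_dimensional H -> 0 <= B.
Proof.
move=> /infinite_dimensional_nonzero[x x0].
have nx0 : 0 < nrm x.
  by rewrite lt_neqAle nrm_ge0 andbT eq_sym; apply: contra x0 => /eqP/nrm0_eq0->.
by have := bessel_fset x fset0; rewrite big_seq_fset0 pmulr_lge0// exprn_gt0.
Qed.

(* With [v] the sum, [|v|^2] is at most the sum of [|c k| * |<v, psi k>|]; by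
   AM-GM [2 a b <= B a^2 + b^2 / B] and the Bessel inequality for [v] this is
   at most half of [B * sum |c k|^2 + |v|^2]. *)
Lemma bessel_sum_le (c : K -> R[i]) (A : {fset K}) : 0 <= B ->
  nrm (\sum_(k <- A) c k *: psi k) ^+ 2 <= B * \sum_(k <- A) nrm (c k) ^+ 2.
Proof.
move=> B_ge0; set v := \sum_(k <- A) _.
have vle : nrm v ^+ 2 <= \sum_(k <- A) nrm (c k) * nrm (inner v (psi k)).
  rewrite -innerxx {1}/v linear_sumlz.
  elim/big_ind2: _ => [|x1 x2 y1 y2 h1 h2|k _]; first by rewrite nrm0.
    by rewrite (le_trans (ler_nrmD _ _))// lerD.
  by rewrite linearZl_LR /= nrmM nrm_innerC.
(* The weighted AM-GM divides by [B], so [B = 0] is treated apart: there the Bessel inequality makes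
   every [inner v (psi k)] vanish. *)
have [B0|B_neq0] := eqVneq B 0.
  have inner0 k : nrm (inner v (psi k)) = 0.
    apply/eqP; rewrite -sqrf_eq0 eq_le sqr_ge0 andbT.
    by have := bessel_fset v [fset k]%fset; rewrite big_seq_fset1 B0 mul0r.
  rewrite B0 mul0r (le_trans vle)// big1// => k _.
  by rewrite inner0 mulr0.
have B_gt0 : 0 < B by rewrite lt_neqAle eq_sym B_neq0.
have : \sum_(k <- A) nrm (c k) * nrm (inner v (psi k)) <=
    \sum_(k <- A) (B * nrm (c k) ^+ 2 / 2 + nrm (inner v (psi k)) ^+ 2 / (2 * B)).
  apply: ler_sum => k _; rewrite -subr_ge0.
  set a := nrm (c k); set b := nrm (inner _ _).
  have -> : B * a ^+ 2 / 2 + b ^+ 2 / (2 * B) - a * b =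
      (B * a - b) ^+ 2 / (2 * B) by field.
  by rewrite divr_ge0 ?sqr_ge0// mulr_ge0.
rewrite big_split /= -!mulr_suml -mulr_sumr => /(le_trans vle).
have : (\sum_(k <- A) nrm (inner v (psi k)) ^+ 2) / (2 * B) <= nrm v ^+ 2 / 2.
  rewrite ler_pdivrMr ?mulr_gt0//.
  have -> : nrm v ^+ 2 / 2 * (2 * B) = B * nrm v ^+ 2 by field.
  exact: bessel_fset.
by lra.
Qed.

Hypothesis B_ge0 : 0 <= B.

Lemma bessel_summable (c : l2 K R) : summable_family (fun k => c k *: psi k).
Proof.
apply: summable_family_cauchy => e e0.
have B1 : 0 < B + 1 by rewrite ltr_wpDl.
(* With tails of [c] below [e ^+ 2 / (B + 1)], the squared norm of a tail of the series is at most
   [B] times such a tail, hence below [e ^+ 2]; the [+ 1] covers [B = 0]. *)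
have [A Ae] := square_summable_tail (l2_valP c) (divr_gt0 (exprn_gt0 2 e0) B1).
exists A => D /Ae; rewrite ltr_pdivlMr// => De.
rewrite -(@ltr_pXn2r _ 2)// ?nnegrE ?nrm_ge0 ?ltW//.
apply: le_lt_trans (bessel_sum_le _ _ B_ge0) _.
apply: le_lt_trans De; rewrite mulrC ler_wpM2l ?lerDl//.
by apply: sumr_ge0 => k _; exact: sqr_ge0.
Qed.

Lemma nrm_synthesis_le (c : l2 K R) :
  nrm (synthesis psi c) <= Num.sqrt B * nrm c.
Proof.
apply: (has_sum_nrm_le _ (summable_has_sum (bessel_summable (c := c)))) => A.
rewrite -(@ler_pXn2r _ 2)// ?nnegrE ?nrm_ge0 ?mulr_ge0 ?sqrtr_ge0 ?nrm_ge0//.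
rewrite (le_trans (bessel_sum_le _ _ B_ge0))// exprMn sqr_sqrtr//.
by rewrite ler_wpM2l// (seqnorm_ubound A (l2_valP c)).
Qed.

Lemma synthesis_linear : linear (synthesis psi : l2 K R -> H).
Proof.
move=> a c d; apply: has_sum_family_sum.
have := has_sum_lin (a := a) (summable_has_sum (bessel_summable (c := c)))
  (summable_has_sum (bessel_summable (c := d))).
congr (has_sum _ _); apply/funext => k.
by rewrite scalerA -scalerDl.
Qed.

Lemma synthesis_bounded_linear :
  (synthesis psi : l2 K R -> H) \in @bounded_linear R (l2 K R) H.
Proof.
apply/asboolP; split; first exact: synthesis_linear.
by exists (Num.sqrt B) => c; exact: nrm_synthesis_le.
Qed.

Definition synthesis_op : 'B(l2 K R, H) := BoundedOp synthesis_bounded_linear.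

Lemma opnorm_synthesis_le : opnorm synthesis_op <= Num.sqrt B.
Proof. by apply: opnorm_le => [|c]; [exact: sqrtr_ge0 | exact: nrm_synthesis_le]. Qed.

Lemma nrm_analysis_le (f : H) : nrm (analysis hpsi f) <= Num.sqrt B * nrm f.
Proof.
have [|A|//] := @seqnorm_le K R (fun k => inner f (psi k)) (Num.sqrt B * nrm f).
  by rewrite mulr_ge0 ?sqrtr_ge0 ?nrm_ge0.
by rewrite exprMn sqr_sqrtr// bessel_fset.
Qed.

Lemma analysis_bounded_linear : analysis hpsi \in @bounded_linear R H (l2 K R).
Proof.
apply/asboolP; split; last by exists (Num.sqrt B) => f; exact: nrm_analysis_le.
move=> a f g; apply/val_inj/funext => k /=.
by rewrite linearPl.
Qed.

Definition analysis_op : 'B(H, l2 K R) := BoundedOp analysis_bounded_linear.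

Lemma opnorm_analysis_le : opnorm analysis_op <= Num.sqrt B.
Proof. by apply: opnorm_le => [|f]; [exact: sqrtr_ge0 | exact: nrm_analysis_le]. Qed.

End bessel_theory.

(** * Composition of bounded operators and two-sided multiplication *)

Section composition.
Variable R : realType.

Lemma comp_bounded_linear (X Y Z : normedModType R[i]) (S : 'B(Y, Z)) (T : 'B(X, Y)) :
  (S \o T : X -> Z) \in @bounded_linear R X Z.
Proof.
apply/asboolP; split; first by move=> a x y; rewrite /= !linearP.
exists (opnorm S * opnorm T) => x /=.
rewrite (le_trans (opnorm_bound _ (bounded_opP S)))// -mulrA.
by rewrite ler_wpM2l ?opnorm_ge0 ?opnorm_bound ?bounded_opP.
Qed.

Definition comp_op (X Y Z : normedModType R[i]) (S : 'B(Y, Z)) (T : 'B(X, Y)) :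
  'B(X, Z) := BoundedOp (comp_bounded_linear S T).

Lemma opnorm_comp_le (X Y Z : normedModType R[i]) (S : 'B(Y, Z)) (T : 'B(X, Y)) :
  opnorm (comp_op S T) <= opnorm S * opnorm T.
Proof.
apply: opnorm_le => [|x]; first by rewrite mulr_ge0 ?opnorm_ge0 ?bounded_opP.
rewrite (le_trans (opnorm_bound _ (bounded_opP S)))// -mulrA.
by rewrite ler_wpM2l ?opnorm_ge0 ?opnorm_bound ?bounded_opP.
Qed.

Variables W X Y Z : normedModType R[i].
Variables (C : 'B(Y, Z)) (D : 'B(W, X)).

Definition sandwich (T : 'B(X, Y)) : 'B(W, Z) := comp_op C (comp_op T D).

Lemma opnorm_sandwich_le (T : 'B(X, Y)) :
  opnorm (sandwich T) <= opnorm C * opnorm D * opnorm T.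
Proof.
rewrite (le_trans (opnorm_comp_le _ _))// -mulrA.
rewrite ler_wpM2l ?opnorm_ge0 ?bounded_opP// mulrC.
exact: opnorm_comp_le.
Qed.

Lemma sandwich_bounded_linear :
  sandwich \in @bounded_linear R 'B(X, Y) 'B(W, Z).
Proof.
apply/asboolP; split.
  move=> a S T; apply/val_inj/funext => x /=.
  by rewrite !fctE /= linearP.
exists (opnorm C * opnorm D) => T; exact: opnorm_sandwich_le.
Qed.

Definition sandwich_op : 'B('B(X, Y), 'B(W, Z)) :=
  BoundedOp sandwich_bounded_linear.

End composition.

(** One squared entry is at most the whole sum of squares. This lets matrix entries be read off from
    a series one row at a time. *)
Lemma coord_bounded_linear (R : realType) (K : countType) (k : K) :
  (fun c : l2 K R => c k) \in @bounded_linear R (l2 K R) R[i]^o.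
Proof.
apply/asboolP; split; first by [].
exists 1 => c; rewrite mul1r -(@ler_pXn2r _ 2)// ?nnegrE ?nrm_ge0//.
by have := seqnorm_ubound [fset k]%fset (l2_valP c); rewrite big_seq_fset1.
Qed.

(** Turns a convergent scalar series of coefficients into a convergent series of multiples of [v],
    as needed for the inner tensor products. *)
Lemma scale_vector_bounded_linear (R : realType) (V : normedModType R[i]) (v : V) :
  (fun a : R[i]^o => a *: v) \in @bounded_linear R R[i]^o V.
Proof.
apply/asboolP; split; first by move=> a x y; rewrite scalerDl scalerA.
by exists (nrm v) => a; rewrite nrmZ mulrC.
Qed.

Theorem theorem3p1 (R : realType) (K : countType) (H1 H2 : hilbertType R)
    (H1_infdim : infinite_dimensional H1) (H2_infdim : infinite_dimensional H2)
    (B B' : R) (Psi : K -> H1) (Phi : K -> H2)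
    (hPsi : bessel B Psi) (hPhi : bessel B' Phi) :
  (exists calM : 'B('B(H1, H2), 'B(l2 K R, l2 K R)),
    forall O : 'B(H1, H2),
      [/\ matrix_defines (operator_matrix Phi Psi O) (calM O),
          opnorm (calM O : 'B(l2 K R, l2 K R)) <= Num.sqrt (B * B') * opnorm O,
          (forall c : l2 K R, summable_family (fun n => c n *: Psi n)) &
          (calM O : 'B(l2 K R, l2 K R))
            =1 analysis hPhi \o O \o synthesis Psi])
  /\
  (exists calO : 'B('B(l2 K R, l2 K R), 'B(H1, H2)),
    forall (M : K -> K -> R[i]) (T : 'B(l2 K R, l2 K R)),
      matrix_defines M T ->
      [/\ (forall h : H1,
             (forall k, @summable_family K R R[i]^o
                          (fun j => M k j * inner h (Psi j))) /\
             summable_family (fun k => matrix_coeff Psi M h k *: Phi k)),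
          (calO T : 'B(H1, H2)) =1 matrix_operator Phi Psi M,
          opnorm (calO T : 'B(H1, H2)) <= Num.sqrt (B * B') * opnorm T,
          (calO T : 'B(H1, H2)) =1 synthesis Phi \o T \o analysis hPsi &
          forall h : H1,
             (forall k, summable_family
                          (fun j => M k j *: inner_tensor (Phi k) (Psi j) h)) /\
             has_sum (fun k => family_sum
                          (fun j => M k j *: inner_tensor (Phi k) (Psi j) h))
                     ((calO T : 'B(H1, H2)) h)]).
Proof.
have B0 := bessel_ge0 hPsi H1_infdim; have B'0 := bessel_ge0 hPhi H2_infdim.
split.
  exists (sandwich_op (analysis_op hPhi B'0) (synthesis_op hPsi B0)) => O.
  split=> //; last by move=> c; exact: bessel_summable.
  - move=> c i /=.
    (* [f] sends [x] to [inner (O x) (Phi i)]. Applied termwise to the synthesis series of [c], it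
       yields the [i]-th row of the matrix acting on [c]. *)
    pose f := (fun x : l2 K R => x i) \o comp_op (analysis_op hPhi B'0) O.
    have fbl : f \in @bounded_linear R H1 R[i]^o.
      exact: comp_bounded_linear (BoundedOp (coord_bounded_linear R i)) _.
    have := has_sum_bounded_linear fbl
      (summable_has_sum (bessel_summable hPsi B0 (c := c))).
    congr (has_sum _ _); apply/funext => n /=.
    by rewrite /f /= linearZ_LR linearZl_LR /= mulrC.
  - rewrite (le_trans (opnorm_sandwich_le _ _ _))//.
    rewrite ler_wpM2r ?opnorm_ge0 ?bounded_opP// mulrC sqrtrM//.
    by rewrite ler_pM ?opnorm_ge0 ?bounded_opP ?opnorm_synthesis_le ?opnorm_analysis_le.
exists (sandwich_op (synthesis_op hPhi B'0) (analysis_op hPsi B0)) => M T MT.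
(* The entries of [analysis hPsi h] are the [inner h (Psi j)], so [MT] gives convergence of the
   series behind [matrix_coeff], which is therefore no junk value. *)
have hM h k := MT (analysis hPsi h) k.
have coeffE h k : matrix_coeff Psi M h k = T (analysis hPsi h) k.
  exact: has_sum_family_sum (hM h k).
have tensor_sum h k :
    has_sum (fun j => M k j *: inner_tensor (Phi k) (Psi j) h)
      (T (analysis hPsi h) k *: Phi k).
  have := has_sum_bounded_linear (scale_vector_bounded_linear (Phi k)) (hM h k).
  by congr (has_sum _ _); apply/funext => j /=; rewrite /inner_tensor scalerA.
have Phi_sum h := bessel_summable hPhi B'0 (c := T (analysis hPsi h)).
split=> //.
- move=> h; split; first by move=> k; exact: has_sum_summable (hM h k).
  by under eq_fun do rewrite coeffE; exact: Phi_sum.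
- by move=> h; rewrite /matrix_operator; under eq_fun do rewrite coeffE.
- rewrite (le_trans (opnorm_sandwich_le _ _ _))//.
  rewrite ler_wpM2r ?opnorm_ge0 ?bounded_opP// mulrC sqrtrM//.
  by rewrite ler_pM ?opnorm_ge0 ?bounded_opP ?opnorm_synthesis_le ?opnorm_analysis_le.
- move=> h; split; first by move=> k; exact: has_sum_summable (tensor_sum h k).
  (* Each inner sum collapses to one multiple of [Phi k]; the outer sum is then the synthesis series
     of [T (analysis hPsi h)]. *)
  under eq_fun do rewrite (has_sum_family_sum (tensor_sum h _)).
  exact: summable_has_sum (Phi_sum h).
Qed.
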